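(* Let $\mathcal{H}$ be an infinite-dimensional separable Hilbert space. The following two assertions, (M1) and (M2), are equivalent. (M1) For every unconditionally convergent multiplier $M_{m,\Phi,\Psi}$ on $\mathcal{H}$, with $\Phi=(\varphi_n)$ and $\Psi=(\psi_n)$ sequences in $\mathcal{H}$ and $m=(m_n)\subset\mathbb{C}$, there exist $(\alpha_n)\subset\mathbb{C}$ and $(\beta_n)\subset\mathbb{C}$ such that $(\alpha_n\varphi_n)$ and $(\beta_n\psi_n)$ are Bessel sequences in $\mathcal{H}$ and $\alpha_n\overline{\beta_n}=m_n$ for all $n$. (M2) For every unconditionally convergent multiplier $M_{m,\Phi,\Psi}$ on $\mathcal{H}$ which is invertible on $\mathcal{H}$, with $\Phi=(\varphi_n)$ and $\Psi=(\psi_n)$ sequences in $\mathcal{H}$ and $m=(m_n)\subset\mathbb{C}$, there exist $(\alpha_n)\subset\mathbb{C}$ and $(\beta_n)\subset\mathbb{C}$ such that $(\alpha_n\varphi_n)$ and $(\beta_n\psi_n)$ are frames for $\mathcal{H}$ and $\alpha_n\overline{\beta_n}=m_n$ for all $n$.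
   Context: The scalars are complex and all sequences are indexed by $\mathbb{N}$. For sequences $\Phi=(\varphi_n)$, $\Psi=(\psi_n)$ in $\mathcal{H}$ and a complex sequence $m=(m_n)$ (the symbol), the multiplier $M_{m,\Phi,\Psi}$ is the operator $M_{m,\Phi,\Psi}f=\sum_n m_n\langle f,\psi_n\rangle\varphi_n$, defined for those $f\in\mathcal{H}$ for which the series converges. It is called unconditionally convergent if the series $\sum_n m_n\langle f,\psi_n\rangle\varphi_n$ converges unconditionally for every $f\in\mathcal{H}$ (a multiplier defined on all of $\mathcal{H}$ is automatically bounded). Invertible on $\mathcal{H}$ means being a bounded bijective operator from $\mathcal{H}$ onto $\mathcal{H}$. A sequence $(f_n)$ in $\mathcal{H}$ is a Bessel sequence in $\mathcal{H}$ if there is $B\in(0,\infty)$ with $\sum_n|\langle f,f_n\rangle|^2\le B\|f\|^2$ for all $f\in\mathcal{H}$. It is a frame for $\mathcal{H}$ if there are $A,B\in(0,\infty)$ with $A\|f\|^2\le\sum_n|\langle f,f_n\rangle|^2\le B\|f\|^2$ for all $f\in\mathcal{H}$. *)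

(* Defs.v *)
From HB Require Import structures.
From mathcomp Require Import all_boot all_order all_algebra.
From mathcomp Require Import complex.
From mathcomp Require Import all_classical all_reals all_analysis.

Set Implicit Arguments.
Unset Strict Implicit.
Unset Printing Implicit Defensive.

Import Order.TTheory GRing.Theory Num.Theory.
Import numFieldNormedType.Exports.

Local Open Scope classical_set_scope.
Local Open Scope ring_scope.

(* The norm of a normed space over [R[i]] takes its values in [R[i]], where
   it is real and nonnegative; [rnorm] is the same norm as an element of [R]. *)
Definition rnorm (R : realType) (V : normedZmodType R[i]) (x : V) : R :=
  complex.Re `|x|.

Definition infinite_dimensional (K : numFieldType) (V : lmodType K) : Prop :=
  ~ exists (n : nat) (e : 'I_n -> V),
      forall x : V, exists c : 'I_n -> K, x = \sum_(i < n) c i *: e i.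

Definition separable_space (T : topologicalType) : Prop :=
  exists2 D : set T, countable D & dense D.

Definition unconditionally_convergent (K : numFieldType) (V : normedModType K)
    (x : nat -> V) : Prop :=
  forall s : nat -> nat, bijective s -> cvgn (series (x \o s)).

(* In {dot H for conjC} the form is linear in its first argument and
   conjugate-linear in the second, conjugate-symmetric and positive definite.
   That it induces the norm of [H] is a hypothesis of the theorem. *)
Section Multipliers.
Variables (R : realType) (H : completeNormedModType R[i]).
Variable dot : {dot H for Num.conj}.
Implicit Types (phi psi g : nat -> H) (m : nat -> R[i]) (T : H -> H).

Definition multiplier_term m phi psi (f : H) : nat -> H :=
  fun n => (m n * dot f (psi n)) *: phi n.

(* [limn] returns a default value where the series diverges, so this is the
   multiplier only on its domain of convergence; it is used only under
   [unconditionally_convergent_multiplier], when the domain is all of [H]. *)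
Definition multiplier m phi psi (f : H) : H :=
  limn (series (multiplier_term m phi psi f)).

Definition unconditionally_convergent_multiplier m phi psi : Prop :=
  forall f : H, unconditionally_convergent (multiplier_term m phi psi f).

Definition bounded_operator T : Prop :=
  linear T /\ exists M : R, forall f, rnorm (T f) <= M * rnorm f.

Definition invertible_operator T : Prop := bounded_operator T /\ bijective T.

Definition analysis_sum g (f : H) : \bar R :=
  (\sum_(0 <= n <oo) (rnorm (dot f (g n)) ^+ 2)%:E)%E.

Definition Bessel g : Prop :=
  exists2 B : R, 0 < B &
    forall f, (analysis_sum g f <= (B * rnorm f ^+ 2)%:E)%E.

Definition frame g : Prop :=
  exists A B : R, [/\ 0 < A, 0 < B &
    forall f, ((A * rnorm f ^+ 2)%:E <= analysis_sum g f)%E /\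
              (analysis_sum g f <= (B * rnorm f ^+ 2)%:E)%E].

End Multipliers.

(* Main.v *)
(** (M1) implies (M2). Put [u = a phi] and [v = b psi]: the multiplier is
    [M f = sum <f, v_n> u_n], with adjoint [N g = sum <g, u_n> v_n]. As [M] is
    onto, uniform boundedness gives [|g| <= C |N g|], and [|N g|^2] is at most a
    multiple of [sum |<g, u_n>|^2]; this is the lower frame bound of [u].
    Moreover [M N] is coercive, hence onto, and [M] is injective, so [N] is onto;
    writing [f = N g] in [|f|^2 = <M f, g>] gives the lower frame bound of [v].

    (M2) implies (M1). By uniform boundedness [|M f| <= C |f|] for some [C].
    Interleaving the multiplier with [f |-> sum (C + 1) <f, e_n> e_n], where [e]
    is an orthonormal basis, yields an unconditionally convergent multiplier for
    [M + (C + 1)], which is invertible by the Neumann series. The coefficients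
    given by (M2), restricted to the even indices, are those wanted in (M1). *)

Require Import Defs.
From HB Require Import structures.
From mathcomp Require Import all_boot all_order all_algebra.
From mathcomp Require Import complex ring lra.
From mathcomp Require Import all_classical all_reals all_analysis.

Set Implicit Arguments.
Unset Strict Implicit.
Unset Printing Implicit Defensive.

Import Order.TTheory GRing.Theory Num.Theory.
Import numFieldNormedType.Exports.

Local Open Scope classical_set_scope.
Local Open Scope ring_scope.

Local Notation "x %:C" := (real_complex _ x) (at level 1).

(** * The norm as a real number *)

Section RealNorm.
Variables (R : realType) (V : normedZmodType R[i]).
Implicit Types x y : V.

Lemma rnormE x : (rnorm x)%:C = `|x|.
Proof. by rewrite /rnorm RRe_real ?normr_real. Qed.

Lemma rnorm_ge0 x : 0 <= rnorm x.
Proof. by rewrite -lecR rnormE normr_ge0. Qed.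

Lemma rnorm_eq0 x : (rnorm x == 0) = (x == 0).
Proof. by rewrite -(inj_eq (@complexI _)) rnormE normr_eq0. Qed.

Lemma rnorm0 : rnorm (0 : V) = 0.
Proof. by apply/eqP; rewrite rnorm_eq0. Qed.

Lemma rnormD x y : rnorm (x + y) <= rnorm x + rnorm y.
Proof. by rewrite -lecR rmorphD /= !rnormE ler_normD. Qed.

Lemma rnormN x : rnorm (- x) = rnorm x.
Proof. by rewrite /rnorm normrN. Qed.

Lemma rnormB x y : rnorm (x - y) <= rnorm x + rnorm y.
Proof. by rewrite (le_trans (rnormD _ _))// rnormN. Qed.

Lemma rdistC x y : rnorm (x - y) = rnorm (y - x).
Proof. by rewrite -opprB rnormN. Qed.

Lemma rdistD z x y : rnorm (x - y) <= rnorm (x - z) + rnorm (z - y).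
Proof. by rewrite (le_trans _ (rnormD _ _))// addrA subrK. Qed.

Lemma rnorm_sum (I : Type) (s : seq I) (F : I -> V) :
  rnorm (\sum_(i <- s) F i) <= \sum_(i <- s) rnorm (F i).
Proof.
elim/big_ind2: _ => // [|x a y b ha hb]; first by rewrite rnorm0.
by rewrite (le_trans (rnormD _ _)) ?lerD.
Qed.

End RealNorm.

Lemma rnormZ (R : realType) (V : normedModType R[i]) (c : R[i]) (x : V) :
  rnorm (c *: x) = rnorm c * rnorm x.
Proof. by apply: complexI; rewrite rmorphM /= !rnormE normrZ. Qed.

Lemma cvg_rnormP (R : realType) (V : normedModType R[i]) (u : nat -> V) (l : V) :
  (u @ \oo --> l) <->
  (forall e : R, 0 < e -> exists N, forall n, (N <= n)%N -> rnorm (l - u n) < e).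
Proof.
split=> [/cvgrPdist_lt ul e e0|ul].
  have /ul[N _ uN] : 0 < e%:C by rewrite ltcR.
  by exists N => n /uN /=; rewrite -rnormE ltcR.
apply/cvgrPdist_lt => e e0.
have eE : (complex.Re e)%:C = e by rewrite RRe_real// gtr0_real.
have [|N uN] := ul (complex.Re e); first by rewrite -ltcR eE.
by exists N => // n /uN /=; rewrite -ltcR rnormE eE.
Qed.

Lemma rnormM (R : realType) (a b : R[i]) : rnorm (a * b) = rnorm a * rnorm b.
Proof. by apply: complexI; rewrite rmorphM /= !rnormE normrM. Qed.

Lemma rnorm_real (R : realType) (a : R) : 0 <= a -> rnorm a%:C = a.
Proof. by move=> a0; apply: complexI; rewrite rnormE ger0_norm// lecR. Qed.

Lemma rnorm_conj (R : realType) (a : R[i]) : rnorm (a^* ) = rnorm a.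
Proof. by rewrite /rnorm norm_conjC. Qed.

(** * Cauchy sequences with an explicit rate *)

Section Completeness.
Variables (R : realType) (H : completeNormedModType R[i]).

Lemma rdist_lim_le (u : nat -> H) (l x : H) (r : R) (n : nat) :
  u @ \oo --> l -> (forall m, (n <= m)%N -> rnorm (u m - x) <= r) ->
  rnorm (l - x) <= r.
Proof.
move=> /cvg_rnormP ul ur; apply/ler_addgt0Pr => e /ul [N uN].
rewrite (le_trans (rdistD (u (maxn n N)) _ _))// addrC lerD//.
  by rewrite ur ?leq_maxl.
by rewrite ltW// uN ?leq_maxr.
Qed.

(** The rate survives in the limit as a non-strict bound, so the limit of the centres of nested
    closed balls lies in all of them. *)
Lemma rcauchy_cvg (u : nat -> H) (r : nat -> R) :
  (forall n m, (n <= m)%N -> rnorm (u m - u n) <= r n) ->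
  (forall e, 0 < e -> exists n, r n < e) ->
  exists2 l, u @ \oo --> l & forall n, rnorm (l - u n) <= r n.
Proof.
move=> ur r0.
have : cvgn u.
  apply/cauchy_cvgP/cauchy_exP => e e0.
  have eE : (complex.Re e)%:C = e by rewrite RRe_real// gtr0_real.
  have [|n rn] := r0 (complex.Re e); first by rewrite -ltcR eE.
  exists (u n); exists n => // m /= nm.
  by rewrite -ball_normE /ball_ /= -rnormE rdistC -eE ltcR (le_lt_trans (ur _ _ nm)).
move=> /cvg_ex [l ul]; exists l => // n.
exact: (rdist_lim_le ul (ur n)).
Qed.
End Completeness.

(** * Uniform boundedness and the Neumann series *)

Section BanachSpace.
Variables (R : realType) (H : completeNormedModType R[i]).

Lemma expr_small (q e : R) : 0 <= q < 1 -> 0 < e -> exists n, q ^+ n < e.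
Proof.
move=> /andP[q0 q1] e0.
have /cvgrPdist_lt/(_ e e0)[N _ /(_ N)] : (fun n => q ^+ n) @ \oo --> (0 : R).
  by apply: cvg_expr; rewrite ger0_norm.
by rewrite /= sub0r normrN ger0_norm ?exprn_ge0// => /(_ (leqnn N)); exists N.
Qed.

(* The nested balls are chosen so that some [p i] exceeds [n] on the [n]-th. *)
Lemma uniform_boundedness (I : Type) (p : I -> H -> R) :
  (forall i x y, p i (x + y) <= p i x + p i y) ->
  (forall i (t : R) x, p i (t%:C *: x) = `|t| * p i x) ->
  (forall i, exists C, forall x, p i x <= C * rnorm x) ->
  (forall x, exists K, forall i, p i x <= K) ->
  exists C, forall i x, p i x <= C * rnorm x.
Proof.
move=> pD pZ pB pK; apply: contrapT => nC.
have pN i x : p i (- x) = p i x.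
  by have := pZ i (-1) x; rewrite rmorphN1 scaleN1r normrN1 mul1r.
(* A vector violating the bound K/r, rescaled to norm r, gives z with p i z > K. Since 2z = (a + z)
   - (a - z), [p i] exceeds K at a + z or at a - z. *)
have big (a : H) (r K : R) : 0 < r ->
    exists i y, rnorm (y - a) <= r /\ K < p i y.
  move=> r0; have [i [x ix]] : exists i x, K / r * rnorm x < p i x.
    apply: contrapT => h; apply: nC; exists (K / r) => i x.
    by rewrite leNgt; apply/negP => ?; apply: h; exists i, x.
  have x0 : 0 < rnorm x.
    rewrite lt_neqAle rnorm_ge0 andbT eq_sym rnorm_eq0; apply/eqP => x0.
    have := pZ i 0 0; rewrite normr0 mul0r scaler0 => p0.
    by move: ix; rewrite x0 rnorm0 mulr0 p0 ltxx.
  pose z := (r / rnorm x)%:C *: x.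
  have pz : K < p i z.
    rewrite pZ ger0_norm ?divr_ge0 ?rnorm_ge0 ?(ltW r0)//.
    by rewrite mulrAC ltr_pdivlMr// mulrC mulrC -ltr_pdivrMl// mulrA (mulrC _ K).
  have nz : rnorm z = r.
    by rewrite rnormZ rnorm_real ?divfK ?gt_eqF// divr_ge0 ?rnorm_ge0 ?(ltW r0).
  have [pa|h] := ltP K (p i (a + z)).
    by exists i, (a + z); split; rewrite // addrC addKr nz.
  exists i, (a - z); split; first by rewrite addrC addKr rnormN nz.
  have := pD i (a + z) (- (a - z)); rewrite pN.
  have -> : a + z + - (a - z) = 2%:C *: z.
    by rewrite rmorph_nat opprB addrC addrA subrK scaler_nat mulr2n.
  rewrite pZ ger0_norm//; lra.
have step (ns : nat * (H * R)) : exists s' : H * R, 0 < ns.2.2 ->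
    [/\ 0 < s'.2, s'.2 <= ns.2.2 / 2, rnorm (s'.1 - ns.2.1) <= ns.2.2 - s'.2 &
      exists i, forall y, rnorm (y - s'.1) <= s'.2 -> ns.1%:R <= p i y].
  case: ns => n [a r] /=; have [r0|] := pselect (0 < r); last by exists (a, r).
  (* At the new centre b, [p i] exceeds n + 1. Within distance 1/(|C| + 1) of b it drops by at most
     1, so it stays above n on the new ball. *)
  have [|i [b [ab ib]]] := big a (r / 2) n.+1%:R; first by lra.
  have [C iC] := pB i.
  have C0 : 0 < `|C| + 1 by have := normr_ge0 C; lra.
  exists (b, Num.min (r / 2) (`|C| + 1)^-1) => _ /=; split.
  - by rewrite lt_min invr_gt0 C0 andbT; lra.
  - by rewrite ge_min lexx.
  - rewrite (le_trans ab)// lerBrDr -lerBrDl.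
    by rewrite ge_min; apply/orP; left; lra.
  - exists i => y; rewrite le_min => /andP[_ yb].
    have := pD i y (b - y); rewrite addrC subrK => h.
    have : p i (b - y) <= 1.
      rewrite (le_trans (iC _))// rdistC.
      rewrite (@le_trans _ _ ((`|C| + 1) * rnorm (y - b)))//.
        by rewrite ler_wpM2r ?rnorm_ge0//; have := ler_norm C; lra.
      by rewrite -ler_pdivlMl// mulr1.
    move: ib; rewrite -natr1; lra.
have [f fP] := choice step.
pose fix s n : H * R := if n is k.+1 then f (k, s k) else (0, 1).
have s0 n : 0 < (s n).2 by elim: n => [|n ih] /=; [lra|have [] := fP (n, s n) ih].
have s2 n : (s n).2 <= 2^-1 ^+ n.
  elim: n => [|n ih]; first by rewrite expr0.
  by have [_ + _ _] := fP (n, s n) (s0 n); rewrite exprS /=; lra.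
have sd n m : (n <= m)%N -> rnorm ((s m).1 - (s n).1) <= (s n).2 - (s m).2.
  move=> /subnK <-; elim: (m - n)%N => [|k ih]; first by rewrite add0n !subrr rnorm0.
  have [_ _ + _] := fP ((k + n)%N, s (k + n)%N) (s0 (k + n)%N); rewrite addSn /= => h.
  by have := rdistD (s (k + n)%N).1 (f ((k + n)%N, s (k + n)%N)).1 (s n).1; lra.
have [||l _ sl] := @rcauchy_cvg _ _ (fun n => (s n).1) (fun n => (s n).2).
- by move=> n m /sd h; rewrite (le_trans h)// gerBl ltW.
- move=> e e0; have [||n ne] := @expr_small 2^-1 e; [lra|by []|].
  by exists n; rewrite (le_lt_trans (s2 n)).
have [K lK] := pK l.
pose n := (Num.truncn K).+1.
have [_ _ _ [i /(_ l (sl n.+1))]] := fP (n, s n) (s0 n).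
by rewrite /= leNgt (le_lt_trans (lK i))// truncnS_gt.
Qed.

Lemma linear_opD (T : H -> H) : linear T -> forall x y, T (x + y) = T x + T y.
Proof. by move=> Tl x y; have := Tl 1 x y; rewrite !scale1r. Qed.

Lemma linear_opN (T : H -> H) : linear T -> forall x, T (- x) = - T x.
Proof.
move=> Tl x; have T0 : T 0 = 0.
  by apply: (@addrI _ (T 0)); rewrite -linear_opD// !addr0.
by have := Tl (-1) x 0; rewrite !addr0 T0 addr0 !scaleN1r.
Qed.

Lemma linear_opB (T : H -> H) : linear T -> forall x y, T (x - y) = T x - T y.
Proof. by move=> Tl x y; rewrite linear_opD// linear_opN. Qed.

(* The inverse is the Neumann series. *)
Lemma near_identity_bijective (T : H -> H) (q : R) : linear T -> 0 <= q < 1 ->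
  (forall x, rnorm (x - T x) <= q * rnorm x) -> bijective T.
Proof.
move=> Tl /andP[q0 q1] Tq.
have injT : injective T.
  move=> x y xy; apply/eqP; rewrite -subr_eq0 -rnorm_eq0 eq_le rnorm_ge0 andbT.
  have := Tq (x - y); rewrite linear_opB// xy subrr subr0.
  by have := rnorm_ge0 (x - y); nra.
have surT g : exists x, T x = g.
  (* Here e n = (1 - T)^n g; it is also the error g - T (s n) left by the n-th partial sum. *)
  pose e n := iter n (fun x => x - T x) g.
  pose s n := \sum_(i < n) e i.
  have en n : rnorm (e n) <= q ^+ n * rnorm g.
    elim: n => [|n ih]; first by rewrite mul1r.
    by rewrite /e iterS (le_trans (Tq _))// exprS -mulrA ler_wpM2l.
  have se n : g - T (s n) = e n.
    elim: n => [|n ih].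
      by rewrite /s big_ord0 -(subrr 0) linear_opB// !subrr subr0.
    by rewrite /s big_ord_recr/= linear_opD// opprD addrA ih.
  pose G := rnorm g / (1 - q).
  have G0 : 0 <= G by rewrite divr_ge0 ?rnorm_ge0//; lra.
  have gG : rnorm g = (1 - q) * G by rewrite mulrC divfK//; apply/eqP; lra.
  (* The geometric sum in closed form, with G = |g|/(1 - q); this shape telescopes in k. *)
  have sd n k : rnorm (s (n + k)%N - s n) <= (q ^+ n - q ^+ (n + k)) * G.
    elim: k => [|k ih]; first by rewrite addn0 !subrr rnorm0 mul0r.
    rewrite addnS /s big_ord_recr/= -/(s _) addrAC (le_trans (rnormD _ _))//.
    by have := en (n + k)%N; rewrite gG exprS; lra.
  have [||l _ sl] := @rcauchy_cvg _ _ s (fun n => q ^+ n * G).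
  - move=> n m /subnKC <-; rewrite (le_trans (sd _ _))// ler_wpM2r//.
    by rewrite gerBl exprn_ge0.
  - move=> eps e0; have [||n ne] := @expr_small q (eps / (G + 1)).
    + by rewrite q0.
    + by rewrite divr_gt0//; lra.
    exists n; move: ne; rewrite ltr_pdivlMr; last by lra.
    by have := exprn_ge0 n q0; nra.
  exists l; apply/eqP; rewrite eq_sym -subr_eq0 -rnorm_eq0 eq_le rnorm_ge0 andbT.
  apply/ler_addgt0Pr => eps e0; rewrite add0r.
  (* The error g - T l is e n - T (l - s n). Its two terms are at most q^n |g| and (1 + q) q^n G;
     the summand 1 makes K positive. *)
  pose K := rnorm g + (1 + q) * G + 1.
  have K0 : 0 < K by rewrite /K; have := rnorm_ge0 g; nra.
  have [||n ne] := @expr_small q (eps / K); first by rewrite q0.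
    by rewrite divr_gt0.
  move: ne; rewrite ltr_pdivlMr// => /ltW; apply: le_trans.
  have -> : g - T l = e n - T (l - s n) by rewrite -se linear_opB// opprB addrA subrK.
  have h1 : rnorm (T (l - s n)) <= (1 + q) * rnorm (l - s n).
    rewrite -[X in T X](subKr (T (l - s n))).
    have := rnormB (l - s n) (l - s n - T (l - s n)).
    rewrite !subKr; have := Tq (l - s n); lra.
  have h2 := rnormB (e n) (T (l - s n)); have := en n; have := sl n.
  by have := exprn_ge0 n q0; rewrite /K; nra.
have [f Tf] := choice surT.
by exists f => x //; apply: injT.
Qed.

End BanachSpace.

(** * The inner product and the Cauchy-Schwarz inequalities *)

Section InnerProduct.
Variables (R : realType) (H : completeNormedModType R[i]).
Variable dot : {dot H for Num.conj}.
Hypothesis dot_norm : forall x : H, dot x x = `|x| ^+ 2.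
Implicit Types (x y z : H) (c : R[i]).

Lemma dotDl x y z : dot (x + y) z = dot x z + dot y z.
Proof. exact: linearDl. Qed.

Lemma dotBl x y z : dot (x - y) z = dot x z - dot y z.
Proof. exact: linearBl. Qed.

Lemma dot0l z : dot 0 z = 0.
Proof. exact: linear0l. Qed.

Lemma dotZl c x z : dot (c *: x) z = c * dot x z.
Proof. exact: linearZl_LR. Qed.

Lemma dotBr x y z : dot x (y - z) = dot x y - dot x z.
Proof. exact: linearBr. Qed.

Lemma dot0r x : dot x 0 = 0.
Proof. exact: linear0r. Qed.

Lemma dotZr c x z : dot x (c *: z) = c^* * dot x z.
Proof. exact: linearZr_LR. Qed.

Lemma dotC x y : dot x y = (dot y x)^*.
Proof. by rewrite (hermC dot) /= expr0 mul1r. Qed.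

Lemma dot_suml (I : Type) (s : seq I) (F : I -> H) z :
  dot (\sum_(i <- s) F i) z = \sum_(i <- s) dot (F i) z.
Proof. exact: (linear_sumlz dot). Qed.

Lemma dot_sumr (I : Type) (s : seq I) (F : I -> H) x :
  dot x (\sum_(i <- s) F i) = \sum_(i <- s) dot x (F i).
Proof. exact: linear_sumr. Qed.

Lemma dotxx x : dot x x = (rnorm x ^+ 2)%:C.
Proof. by rewrite dot_norm -rnormE rmorphXn. Qed.

Lemma conjC_real (a : R) : (a%:C)^* = a%:C.
Proof. by rewrite conj_Creal// complex_real. Qed.

Lemma mul_conjC_rnorm c : c * c^* = (rnorm c ^+ 2)%:C.
Proof. by rewrite -normCK -rnormE rmorphXn. Qed.

Lemma rnorm_dotC x y : rnorm (dot x y) = rnorm (dot y x).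
Proof. by rewrite dotC rnorm_conj. Qed.

Lemma cauchy_schwarz x y : rnorm (dot x y) <= rnorm x * rnorm y.
Proof.
have [->|y0] := eqVneq y 0; first by rewrite dot0r !rnorm0 mulr0.
have y1 : 0 < rnorm y by rewrite lt_neqAle rnorm_ge0 eq_sym rnorm_eq0 y0.
suff : rnorm (dot x y) ^+ 2 <= (rnorm x * rnorm y) ^+ 2.
  by rewrite ler_pXn2r// nnegrE ?mulr_ge0 ?rnorm_ge0.
pose a := (rnorm y ^+ 2)%:C.
(* This is |y|^2 times the component of x orthogonal to y, so no division occurs. *)
have : dot (a *: x - dot x y *: y) (a *: x - dot x y *: y) =
    (rnorm y ^+ 2 * ((rnorm x * rnorm y) ^+ 2 - rnorm (dot x y) ^+ 2))%:C.
  rewrite dotBl !dotBr !dotZl !dotZr conjC_real !dotxx (dotC y x) -/a.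
  rewrite (rmorphM (real_complex R) (rnorm y ^+ 2) (_ - _)).
  rewrite (rmorphB (real_complex R)) exprMn.
  rewrite (rmorphM (real_complex R) (rnorm x ^+ 2) (rnorm y ^+ 2)) /=.
  by rewrite -mul_conjC_rnorm -/a; ring.
rewrite dotxx => /complexI h.
have : 0 <= rnorm y ^+ 2 * ((rnorm x * rnorm y) ^+ 2 - rnorm (dot x y) ^+ 2).
  by rewrite -h sqr_ge0.
by rewrite pmulr_rge0 ?exprn_gt0// subr_ge0.
Qed.

Lemma sum_cauchy_schwarz (I : Type) (s : seq I) (a b : I -> R) :
  (\sum_(i <- s) a i * b i) ^+ 2 <=
  (\sum_(i <- s) a i ^+ 2) * (\sum_(i <- s) b i ^+ 2).
Proof.
elim: s => [|i s ih]; first by rewrite !big_nil mul0r expr0n.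
rewrite !big_cons.
have A0 : 0 <= \sum_(j <- s) a j ^+ 2 by apply: sumr_ge0 => j _; exact: sqr_ge0.
have B0 : 0 <= \sum_(j <- s) b j ^+ 2 by apply: sumr_ge0 => j _; exact: sqr_ge0.
move: ih A0 B0; set S := \sum_(j <- s) _; set A := \sum_(j <- s) _.
set B := \sum_(j <- s) _; move: (a i) (b i) => x y SAB A0 B0.
(* The cross term of the induction: S^2 <= AB, and then the arithmetic-geometric mean inequality for
   A y^2 and x^2 B. *)
have h : (2 * S * (x * y)) ^+ 2 <= (A * y ^+ 2 + x ^+ 2 * B) ^+ 2.
  rewrite (@le_trans _ _ (4 * (A * B) * (x * y) ^+ 2))//.
    by have := ler_wpM2r (sqr_ge0 (x * y)) SAB; lra.
  by have := sqr_ge0 (A * y ^+ 2 - x ^+ 2 * B); lra.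
have : 2 * S * (x * y) <= A * y ^+ 2 + x ^+ 2 * B.
  rewrite (le_trans (ler_norm _))// -(@ler_pXn2r _ 2) ?nnegrE ?normr_ge0//.
    by rewrite real_normK ?num_real.
  by apply: addr_ge0; apply: mulr_ge0; rewrite ?sqr_ge0.
lra.
Qed.

End InnerProduct.

Lemma linear_lim_series (K : numFieldType) (V : normedModType K)
    (F : V -> nat -> V) :
  (forall n, linear (F^~ n)) -> (forall f, cvgn (series (F f))) ->
  linear (fun f => limn (series (F f))).
Proof.
move=> Fl Fc c x y; apply: cvg_lim => //.
have -> : series (F (c *: x + y)) = c *: series (F x) + series (F y).
  apply/funext => n; rewrite -[RHS]/(c *: series (F x) n + series (F y) n).
  rewrite /series /= scaler_sumr -big_split /=.
  by apply: eq_bigr => i _; exact: Fl.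
by apply: cvgD; [apply: cvgZl_tmp; exact: Fc|exact: Fc].
Qed.

(** * Bessel sequences and their synthesis operators *)

Section Bessel.
Variables (R : realType) (H : completeNormedModType R[i]).
Variable dot : {dot H for Num.conj}.
Hypothesis dot_norm : forall x : H, dot x x = `|x| ^+ 2.
Implicit Types (f : H) (g u v : nat -> H).

(** The partial sums of [analysis_sum], kept in [R] so that estimates avoid extended reals. *)
Definition energy g f n : R := \sum_(0 <= i < n) rnorm (dot f (g i)) ^+ 2.

Lemma analysis_sum_leP g f (K : R) :
  (analysis_sum dot g f <= K%:E)%E <-> forall n, energy g f n <= K.
Proof.
have pos n : (0 <= (rnorm (dot f (g n)) ^+ 2)%:E)%E by rewrite lee_fin sqr_ge0.
split=> [h n|h].
  rewrite -lee_fin /energy -sumEFin (le_trans _ h)//.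
  exact: nneseries_lim_ge.
apply: lime_le; first exact: is_cvg_nneseries.
by apply: nearW => n /=; rewrite sumEFin lee_fin; exact: h.
Qed.

(** An infinite sum satisfies every lower bound, so only real upper bounds of the partial sums have
    to be tested. *)
Lemma le_analysis_sum g f (a : R) :
  (forall s, (forall n, energy g f n <= s) -> a <= s) ->
  (a%:E <= analysis_sum dot g f)%E.
Proof.
move=> h; case E : (analysis_sum dot g f) => [s| |]; last 2 first.
- by rewrite leey.
- suff : (0 <= analysis_sum dot g f)%E by rewrite E.
  by apply: nneseries_ge0 => n _ _; rewrite lee_fin sqr_ge0.
by rewrite lee_fin; apply: h; apply/analysis_sum_leP; rewrite E.
Qed.

Lemma BesselP g : Bessel dot g <->
  exists2 B : R, 0 < B & forall f n, energy g f n <= B * rnorm f ^+ 2.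
Proof.
by split=> -[B B0 h]; exists B => // f; apply/analysis_sum_leP; exact: h.
Qed.

Lemma energy_ge0 g f n : 0 <= energy g f n.
Proof. by apply: sumr_ge0 => i _; exact: sqr_ge0. Qed.

(** Pairing the sum w with itself gives |w|^2 <= sum |c_i| |<w, g_i>|. By Cauchy-Schwarz and the
    Bessel bound, |w|^4 <= S B |w|^2, and |w|^2 cancels. *)
Lemma synthesis_le g (B : R) (c : nat -> R[i]) p q : 0 <= B ->
  (forall f n, energy g f n <= B * rnorm f ^+ 2) ->
  rnorm (\sum_(p <= i < q) c i *: g i) ^+ 2 <=
  B * \sum_(p <= i < q) rnorm (c i) ^+ 2.
Proof.
move=> B0 gB; set w := \sum_(p <= i < q) _; set X := rnorm w ^+ 2.
set S := \sum_(p <= i < q) _.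
have S0 : 0 <= S by apply: sumr_ge0 => i _; exact: sqr_ge0.
have X0 : 0 <= X by exact: sqr_ge0.
have XS : X <= \sum_(p <= i < q) rnorm (c i) * rnorm (dot w (g i)).
  rewrite -(rnorm_real X0) -(dotxx dot_norm) {1}/w dot_suml.
  rewrite (le_trans (rnorm_sum _ _))// ler_sum// => i _.
  by rewrite dotZl rnormM rnorm_dotC.
have wB : \sum_(p <= i < q) rnorm (dot w (g i)) ^+ 2 <= B * X.
  apply: le_trans (gB w q); rewrite /energy.
  have [pq|qp] := leqP p q; last by rewrite big_geq ?energy_ge0// ltnW.
  by rewrite [leRHS](@big_cat_nat _ _ _ p) //= lerDr energy_ge0.
have BX0 : 0 <= B * X.
  by apply: le_trans wB; apply: sumr_ge0 => i _; exact: sqr_ge0.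
have : X ^+ 2 <= S * (B * X).
  apply: (@le_trans _ _ ((\sum_(p <= i < q) rnorm (c i) * rnorm (dot w (g i))) ^+ 2)).
    by rewrite ler_pXn2r ?nnegrE// (le_trans X0).
  by rewrite (le_trans (sum_cauchy_schwarz _ _ _))// ler_wpM2l.
have [->|Xn0] := eqVneq X 0; last first.
  have X1 : 0 < X by rewrite lt_neqAle eq_sym Xn0.
  by rewrite expr2 mulrA ler_pM2r// mulrC.
by move=> _; exact: mulr_ge0.
Qed.

Lemma synthesis_cvg g (B : R) (c : nat -> R[i]) (K : R) : 0 <= B ->
  (forall f n, energy g f n <= B * rnorm f ^+ 2) ->
  (forall n, \sum_(0 <= i < n) rnorm (c i) ^+ 2 <= K) ->
  exists2 l, series (fun i => c i *: g i) @ \oo --> l & rnorm l ^+ 2 <= B * K.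
Proof.
move=> B0 gB cK; pose s n := \sum_(0 <= i < n) rnorm (c i) ^+ 2.
have sup_s : has_sup (range s).
  by split; [exists (s 0); exists 0|exists K => _ [n _ <-]; exact: cK].
pose L := sup (range s).
have sL n : s n <= L by apply: sup_upper_bound => //; exists n.
have LK : L <= K by apply: ge_sup;
  [exists (s 0); exists 0|move=> _ [n _ <-]; exact: cK].
have BL n : 0 <= B * (L - s n) by rewrite mulr_ge0// subr_ge0.
(* By [synthesis_le] a block starting at n has squared norm at most B (L - s n), where L is the sum
   of all |c_i|^2. The rate at n = 0 then bounds the limit. *)
have [n m nm|e e0|l cl lr] :=
    @rcauchy_cvg _ _ (series (fun i => c i *: g i)) (fun n => Num.sqrt (B * (L - s n))).
- rewrite -[leLHS]ger0_norm ?rnorm_ge0// -sqrtr_sqr ler_wsqrtr//.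
  rewrite sub_series_geq// (le_trans (synthesis_le _ _ _ B0 gB))// ler_wpM2l//.
  by rewrite lerBrDl /s -big_cat_nat//=; exact: sL.
(* Dividing by B + 1 covers the case B = 0. *)
- have [|_ [n _ <-] Ln] := @sup_adherent _ _ (e ^+ 2 / (B + 1)) _ sup_s.
    by rewrite divr_gt0 ?exprn_gt0//; lra.
  exists n; rewrite -[e]ger0_norm ?(ltW e0)// -sqrtr_sqr ltr_sqrt ?exprn_gt0//.
  have : L - s n < e ^+ 2 / (B + 1) by move: Ln; rewrite -/L; lra.
  rewrite ltr_pdivlMr; last by lra.
  by have := sL n; have := exprn_gt0 2 e0; nra.
- exists l => //; have := lr 0; rewrite /s /series /= !big_geq// !subr0.
  have BL0 : 0 <= B * L by rewrite (le_trans (BL 0%N))// /s big_geq// subr0.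
  move=> h; rewrite (@le_trans _ _ (B * L))// ?ler_wpM2l//.
  rewrite -[leRHS]sqr_sqrtr// ler_pXn2r ?nnegrE ?rnorm_ge0 ?sqrtr_ge0//.
Qed.

(** The mixed frame operator: synthesis by [u] after analysis by [v], or the multiplier with
    constant symbol 1. *)
Definition analysis_synthesis u v f : H := limn (series (fun n => dot f (v n) *: u n)).

Section TwoBessel.
Variables (u v : nat -> H) (Bu Bv : R).
Hypotheses (Bu0 : 0 <= Bu) (Bv0 : 0 <= Bv).
Hypothesis uB : forall f n, energy u f n <= Bu * rnorm f ^+ 2.
Hypothesis vB : forall f n, energy v f n <= Bv * rnorm f ^+ 2.

Lemma analysis_synthesis_cvg f :
  series (fun n => dot f (v n) *: u n) @ \oo --> analysis_synthesis u v f.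
Proof.
by have [l ul _] := synthesis_cvg Bu0 uB (vB f); apply/cvg_ex; exists l.
Qed.

Lemma analysis_synthesis_le f K : (forall n, energy v f n <= K) ->
  rnorm (analysis_synthesis u v f) ^+ 2 <= Bu * K.
Proof.
move=> vK; have [l ul] := synthesis_cvg Bu0 uB vK.
by congr (rnorm _ ^+ 2 <= _); apply/esym/cvg_lim.
Qed.

Lemma analysis_synthesis_linear : linear (analysis_synthesis u v).
Proof.
apply: linear_lim_series => [n c x y|f].
  by rewrite dotDl dotZl scalerDl scalerA.
by apply/cvg_ex; eexists; exact: analysis_synthesis_cvg.
Qed.

End TwoBessel.

(** Partial sums are adjoint term by term; both series converge in norm, and Cauchy-Schwarz carries
    the identity to the limits. *)
Lemma analysis_synthesis_adjoint u v (Bu Bv : R) f h : 0 <= Bu -> 0 <= Bv ->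
  (forall f n, energy u f n <= Bu * rnorm f ^+ 2) ->
  (forall f n, energy v f n <= Bv * rnorm f ^+ 2) ->
  dot (analysis_synthesis u v f) h = dot f (analysis_synthesis v u h).
Proof.
move=> Bu0 Bv0 uB vB; set M := analysis_synthesis u v f.
set N := analysis_synthesis v u h.
apply/eqP; rewrite -subr_eq0 -rnorm_eq0 eq_le rnorm_ge0 andbT.
apply/ler_addgt0Pr => e e0; rewrite add0r.
pose d := e / (rnorm h + rnorm f + 1).
have hf : 0 < rnorm h + rnorm f + 1 by have := rnorm_ge0 h; have := rnorm_ge0 f; lra.
have d0 : 0 < d by rewrite divr_gt0.
have /cvg_rnormP/(_ d d0)[n1 M1] := analysis_synthesis_cvg Bu0 uB vB (f := f).
have /cvg_rnormP/(_ d d0)[n2 N2] := analysis_synthesis_cvg Bv0 vB uB (f := h).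
pose n := maxn n1 n2.
have {M1} := M1 n (leq_maxl _ _); have {N2} := N2 n (leq_maxr _ _).
rewrite -/M -/N; set Nn := series _ n; set Mn := series _ n => Nd Md.
have MN : dot Mn h = dot f Nn.
  rewrite dot_suml dot_sumr; apply: eq_bigr => i _.
  by rewrite dotZl dotZr -dotC mulrC.
have -> : dot M h - dot f N = dot (M - Mn) h - dot f (N - Nn).
  by rewrite dotBl dotBr MN opprB addrA subrK.
have h1 := cauchy_schwarz dot_norm (M - Mn) h.
have h2 := cauchy_schwarz dot_norm f (N - Nn).
have := rnormB (dot (M - Mn) h) (dot f (N - Nn)).
have de : d * (rnorm h + rnorm f + 1) = e by rewrite divfK// gt_eqF.
have := rnorm_ge0 h; have := rnorm_ge0 f.
by nra.
Qed.

End Bessel.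

Lemma rnorm_realE (R : realType) (t : R) : rnorm t%:C = `|t|.
Proof.
have [t0|t0] := leP 0 t; first by rewrite rnorm_real// ger0_norm.
by rewrite -rnormN -rmorphN rnorm_real ?ler0_norm// ?oppr_ge0 ltW.
Qed.

(** * From an invertible mixed frame operator to lower frame bounds *)

Section Inversion.
Variables (R : realType) (H : completeNormedModType R[i]).
Variable dot : {dot H for Num.conj}.
Hypothesis dot_norm : forall x : H, dot x x = `|x| ^+ 2.

(* The functionals [dot ^~ y] with [|N y| <= 1] are pointwise bounded, because
   [|<M h, y>| = |<h, N y>| <= |h|]. *)
Lemma adjoint_bounded_below (M N : H -> H) : linear N ->
  (forall x y, dot (M x) y = dot x (N y)) -> (forall y, exists x, M x = y) ->
  exists2 C, 0 < C & forall y, rnorm y <= C * rnorm (N y).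
Proof.
move=> Nl adj surM; pose I := {y : H | rnorm (N y) <= 1}.
have [||[y y1]|x|C yC] := @uniform_boundedness R H I (fun y x => rnorm (dot x (sval y))).
- by move=> i x y; rewrite dotDl rnormD.
- by move=> i t x; rewrite dotZl rnormM rnorm_realE.
- by exists (rnorm y) => x /=; rewrite mulrC cauchy_schwarz.
- have [h <-] := surM x; exists (rnorm h) => -[y y1] /=; rewrite adj.
  rewrite (le_trans (cauchy_schwarz dot_norm _ _))//.
  by rewrite -[leRHS]mulr1 ler_wpM2l ?rnorm_ge0.
exists (`|C| + 1) => [|y]; first by have := normr_ge0 C; lra.
have C1 : 0 < `|C| + 1 by have := normr_ge0 C; lra.
(* The functional given by x, evaluated at x itself, yields |x|^2 <= C |x|. *)
have small x : rnorm (N x) <= 1 -> rnorm x <= `|C| + 1.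
  move=> x1; have := yC (exist _ x x1) x; rewrite /= dotxx// rnorm_real ?sqr_ge0//.
  by have := ler_norm C; have := rnorm_ge0 x; nra.
have NZ c x : N (c *: x) = c *: N x.
  have N0 : N 0 = 0 by have := linear_opB Nl 0 0; rewrite !subrr.
  by have := Nl c x 0; rewrite N0 !addr0.
(* The slack keeps t positive even if N y = 0; [small] is applied to y/t, and (|C| + 1) t = (|C| +
   1) |N y| + e. *)
apply/ler_addgt0Pr => e e0; pose t := rnorm (N y) + e / (`|C| + 1).
have t0 : 0 < t by rewrite ltr_wpDl ?rnorm_ge0// divr_gt0.
have := small ((t^-1)%:C *: y); rewrite NZ !rnormZ rnorm_real ?invr_ge0 ?(ltW t0)//.
rewrite ler_pdivrMl// mulr1 ler_pdivrMl// => h.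
rewrite (le_trans (h _)) ?lerDl ?divr_ge0 ?(ltW e0) ?(ltW C1)//.
by rewrite /t mulrDl divfK ?gt_eqF// mulrC.
Qed.

Lemma rnormB_sqr x y : rnorm (x - y) ^+ 2 =
  rnorm x ^+ 2 - 2 * complex.Re (dot x y) + rnorm y ^+ 2.
Proof.
have := dotxx dot_norm (x - y); rewrite dotBl !dotBr !dotxx// (dotC _ y x).
have : complex.Re (dot x y)^* = complex.Re (dot x y).
  by apply: complexI; rewrite !complexRe Re_conj.
case: (dot x y) ((dot x y)^*) => a b [a' b'] /= -> /(congr1 (@complex.Re R)) /= <-.
by lra.
Qed.

(* The adjoint [N] is onto because [M N] is coercive, so that [1 - t M N] is a
   contraction for a suitable [t]. *)
Lemma adjoint_surjective (M N : H -> H) (C K : R) : linear M -> linear N ->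
  (forall x y, dot (M x) y = dot x (N y)) -> injective M ->
  0 < C -> (forall y, rnorm y <= C * rnorm (N y)) ->
  0 <= K -> (forall y, rnorm (M (N y)) <= K * rnorm y) ->
  forall x, exists y, N y = x.
Proof.
move=> Ml Nl adj injM C0 NC K0 MK.
(* Coercivity reads <M N x, x> = |N x|^2 >= c |x|^2, and |M N x|^2 <= D |x|^2. Hence |x - t M N x|^2
   <= (1 - 2tc + t^2 D) |x|^2, which is q |x|^2 as t D = c. The term c^2 in D ensures tc <= 1, so q
   >= 0. *)
pose c := (C ^+ 2)^-1; pose D := K ^+ 2 + c ^+ 2; pose t := c / D.
have c0 : 0 < c by rewrite invr_gt0 exprn_gt0.
have D0 : 0 < D by rewrite ltr_wpDl ?sqr_ge0 ?exprn_gt0.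
have tD : t * D = c by rewrite divfK// gt_eqF.
have t0 : 0 < t by rewrite divr_gt0.
pose q := 1 - t * c.
have q01 : 0 <= q < 1.
  rewrite /q subr_ge0 gtrBl mulr_gt0// andbT mulrAC ler_pdivrMr// mul1r.
  by rewrite /D lerDr sqr_ge0.
have Pl : linear (fun x => t%:C *: M (N x)).
  by move=> a x y; rewrite Nl Ml scalerDr scalerA mulrC -scalerA.
have [||g gK gK'] := near_identity_bijective (q := Num.sqrt q) Pl.
- rewrite sqrtr_ge0 /= -[ltRHS]sqrtr1 ltr_sqrt//; by case/andP: q01.
- move=> x; rewrite -[leLHS]ger0_norm ?rnorm_ge0// -sqrtr_sqr.
  rewrite -[X in _ <= _ * X]ger0_norm ?rnorm_ge0// -sqrtr_sqr.
  rewrite -sqrtrM; last by case/andP: q01.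
  rewrite ler_wsqrtr// rnormB_sqr dotZr conjC_real dotC adj dotxx// conjC_real -rmorphM /=.
  rewrite rnormZ rnorm_real ?(ltW t0)// exprMn.
  have h1 : c * rnorm x ^+ 2 <= rnorm (N x) ^+ 2.
    rewrite ler_pdivrMl ?exprn_gt0// -exprMn ler_pXn2r ?nnegrE ?rnorm_ge0//.
    by rewrite mulr_ge0 ?rnorm_ge0// ltW.
  have h2 : rnorm (M (N x)) ^+ 2 <= D * rnorm x ^+ 2.
    rewrite (@le_trans _ _ ((K * rnorm x) ^+ 2))//.
      by rewrite ler_pXn2r ?nnegrE ?mulr_ge0 ?rnorm_ge0.
    by rewrite exprMn ler_wpM2r ?sqr_ge0// /D lerDl sqr_ge0.
  have h3 := ler_wpM2l (ltW t0) h1.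
  have h4 := ler_wpM2l (sqr_ge0 t) h2.
  have h5 : t ^+ 2 * (D * rnorm x ^+ 2) = t * (c * rnorm x ^+ 2).
    by rewrite -tD; ring.
  by rewrite /q; lra.
(* As g inverts t M N, applying M N to this witness gives M x. *)
move=> x; exists (t%:C *: g (M x)); apply: injM.
have NZ z : N (t%:C *: z) = t%:C *: N z.
  have N0 : N 0 = 0 by have := linear_opB Nl 0 0; rewrite !subrr.
  by have := Nl t%:C z 0; rewrite N0 !addr0.
have MZ z : M (t%:C *: z) = t%:C *: M z.
  have M0 : M 0 = 0 by have := linear_opB Ml 0 0; rewrite !subrr.
  by have := Ml t%:C z 0; rewrite M0 !addr0.
by rewrite NZ MZ gK'.
Qed.

Lemma analysis_synthesis_frames u v : Bessel dot u -> Bessel dot v ->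
  bijective (analysis_synthesis dot u v) -> frame dot u /\ frame dot v.
Proof.
move=> /BesselP[Bu Bu0 uB] /BesselP[Bv Bv0 vB] bijM.
set M := analysis_synthesis dot u v in bijM.
pose N := analysis_synthesis dot v u.
have Bu0' := ltW Bu0; have Bv0' := ltW Bv0.
have Ml : linear M := analysis_synthesis_linear dot_norm Bu0' uB vB.
have Nl : linear N := analysis_synthesis_linear dot_norm Bv0' vB uB.
have adj f h : dot (M f) h = dot f (N h).
  exact: (analysis_synthesis_adjoint _ _ _ Bu0' Bv0').
have surM y : exists x, M x = y by have [g gK gK'] := bijM; exists (g y).
have Mle f K : (forall n, energy dot v f n <= K) -> rnorm (M f) ^+ 2 <= Bu * K.
  exact: analysis_synthesis_le.
have Nle f K : (forall n, energy dot u f n <= K) -> rnorm (N f) ^+ 2 <= Bv * K.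
  exact: analysis_synthesis_le.
have [C C0 NC] := adjoint_bounded_below Nl adj surM.
have C20 : 0 < C ^+ 2 by rewrite exprn_gt0.
have surN : forall x, exists y, N y = x.
  (* |M N y|^2 <= Bu Bv |N y|^2, and |N y|^2 <= Bv Bu |y|^2. *)
  apply: (adjoint_surjective (K := Bu * Bv) Ml Nl adj (bij_inj bijM) C0 NC) => [|y].
    by rewrite mulr_ge0.
  rewrite -(@ler_pXn2r _ 2) ?nnegrE ?mulr_ge0 ?rnorm_ge0//.
  rewrite (le_trans (Mle _ _ (vB _)))// exprMn.
  have := Nle _ _ (uB y).
  rewrite -(ler_pM2l Bv0) -(ler_pM2l Bu0); lra.
have sqle (x y : H) c : 0 <= c -> rnorm x <= c * rnorm y ->
    rnorm x ^+ 2 <= c ^+ 2 * rnorm y ^+ 2.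
  by move=> c0 xy; rewrite -exprMn ler_pXn2r ?nnegrE ?rnorm_ge0// mulr_ge0 ?rnorm_ge0.
split.
  (* From |f|^2 <= C^2 |N f|^2 <= C^2 Bv s, for every bound s of the energy of f along [u]. *)
  exists (C ^+ 2 * Bv)^-1, Bu; split => [||f]; rewrite ?invr_gt0 ?mulr_gt0//.
  split; last by apply/analysis_sum_leP.
  apply: le_analysis_sum => s us; rewrite ler_pdivrMl ?mulr_gt0//.
  rewrite (le_trans (sqle _ _ C (ltW C0) (NC f)))//.
  by rewrite -[leRHS]mulrA ler_pM2l// Nle.
exists (C ^+ 2 * Bu)^-1, Bv; split => [||f]; rewrite ?invr_gt0 ?mulr_gt0//.
split; last by apply/analysis_sum_leP.
apply: le_analysis_sum => s vs; rewrite ler_pdivrMl ?mulr_gt0//.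
rewrite (@le_trans _ _ (C ^+ 2 * rnorm (M f) ^+ 2))//; last first.
  by rewrite -[leRHS]mulrA ler_pM2l// Mle.
apply: sqle; first exact: ltW.
(* |f|^2 = <M f, g> <= |M f| |g| and |g| <= C |f|; cancelling |f| leaves |f| <= C |M f|. *)
have [g gf] := surN f; have := cauchy_schwarz dot_norm (M f) g.
rewrite adj gf dotxx// rnorm_real ?sqr_ge0//.
have := NC g; rewrite gf; have := rnorm_ge0 f; have := rnorm_ge0 (M f).
have [->|f0 M0 f1 gC h] := eqVneq (rnorm f) 0.
  by move=> M0 _ _ _; rewrite mulr_ge0// ltW.
have f2 : 0 < rnorm f by rewrite lt_neqAle eq_sym f0.
rewrite -(ler_pM2r f2) -expr2 (le_trans h)// mulrAC mulrC ler_wpM2r//.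
Qed.

End Inversion.

(** * Gram-Schmidt and orthonormal expansions *)

Section Orthonormal.
Variables (R : realType) (H : completeNormedModType R[i]).
Variable dot : {dot H for Num.conj}.
Hypothesis dot_norm : forall x : H, dot x x = `|x| ^+ 2.
Implicit Types (f x y : H) (d e : nat -> H).

(* Zero vectors are allowed, so that no linear independence is needed. *)
Definition orthonormal_or_zero e :=
  forall i j, dot (e i) (e j) = ((i == j) && (e i != 0))%:R.

Lemma orthonormal_or_zero_comp e (s : nat -> nat) : injective s ->
  orthonormal_or_zero e -> orthonormal_or_zero (e \o s).
Proof. by move=> si eo i j; rewrite /= eo (inj_eq si). Qed.

(** Expand |f - S|^2 >= 0 for the partial expansion S of f: both <f, S> and |S|^2 equal the
    energy. *)
Lemma bessel_inequality e f n :
  orthonormal_or_zero e -> energy dot e f n <= rnorm f ^+ 2.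
Proof.
move=> eo; set E := energy _ _ _ _.
pose S := \sum_(0 <= i < n) dot f (e i) *: e i.
have fS : dot f S = E%:C.
  rewrite dot_sumr rmorph_sum; apply: eq_bigr => i _.
  by rewrite dotZr mulrC mul_conjC_rnorm.
have eS i : (0 <= i < n)%N ->
      dot (dot f (e i) *: e i) S = (rnorm (dot f (e i)) ^+ 2)%:C.
  move=> /andP[_ ni]; rewrite dotZl dot_sumr (bigD1_seq i) ?mem_index_iota ?iota_uniq//=.
  rewrite big1 => [|j /negPf ji]; last by rewrite dotZr eo eq_sym ji mulr0.
  rewrite addr0 dotZr eo eqxx /= mulrCA mulrC -mul_conjC_rnorm.
  have [->|] := eqVneq (e i) 0; first by rewrite dot0r !(mulr0, mul0r).
  by rewrite mulr1 mulrC.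
have SS : rnorm S ^+ 2 = E.
  apply: complexI; rewrite -(dotxx dot_norm) {1}/S dot_suml rmorph_sum.
  by rewrite big_nat_cond [RHS]big_nat_cond; apply: eq_bigr => i /andP[/eS].
have := rnormB_sqr dot_norm f S; rewrite fS SS /= => h.
by have := sqr_ge0 (rnorm (f - S)); lra.
Qed.

(** A rearrangement of [e] is again orthonormal or zero, hence Bessel with bound 1, and
    [synthesis_cvg] applies. *)
Lemma orthonormal_expansion_unconditional e f : orthonormal_or_zero e ->
  unconditionally_convergent (fun n => dot f (e n) *: e n).
Proof.
move=> eo s /bij_inj si; have eso := orthonormal_or_zero_comp si eo.
have [|||l el _] := @synthesis_cvg _ _ _ dot_norm (e \o s) 1 (fun n => dot f (e (s n)))
    (rnorm f ^+ 2) => //.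
- by move=> g n; rewrite mul1r bessel_inequality.
- by move=> n; exact: (bessel_inequality f n eso).
by apply/cvg_ex; exists l.
Qed.

Definition normalize x : H := ((rnorm x)^-1)%:C *: x.

Lemma normalize_eq0 x : (normalize x == 0) = (x == 0).
Proof.
rewrite /normalize scaler_eq0; have [->|x0] := eqVneq x 0; first by rewrite orbT.
by rewrite orbF fmorph_eq0 invr_eq0 rnorm_eq0 (negPf x0).
Qed.

Lemma dot_normalize x : dot x (normalize x) = (rnorm x)%:C.
Proof.
rewrite dotZr conjC_real dotxx// -rmorphM /=; congr _%:C.
have [->|x0] := eqVneq (rnorm x) 0; first by rewrite mulrC expr0n mul0r.
by rewrite expr2 mulKf.
Qed.

Lemma rnorm_normalizeK x : (rnorm x)%:C *: normalize x = x.
Proof.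
rewrite scalerA -rmorphM /=.
have [->|x0] := eqVneq x 0; first by rewrite scaler0.
by rewrite divff ?rnorm_eq0// scale1r.
Qed.

Lemma dot_normalize_self x : dot (normalize x) (normalize x) = (normalize x != 0)%:R.
Proof.
rewrite normalize_eq0 {1}/normalize dotZl dot_normalize -rmorphM /=.
have [->|x0] := eqVneq x 0; first by rewrite rnorm0 mulr0.
by rewrite mulVf ?rnorm_eq0.
Qed.

(** Modified Gram-Schmidt, run on an arbitrary [x]: at [d n] it produces the next basis vector, and
    at any f the remainder of the expansion of f. *)
Fixpoint gs_residual d n x : H :=
  if n is k.+1 then
    let e := normalize (gs_residual d k (d k)) in
    gs_residual d k x - dot (gs_residual d k x) e *: e
  else x.

Definition gram_schmidt d n := normalize (gs_residual d n (d n)).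

Lemma gs_residualS d n x : gs_residual d n.+1 x =
  gs_residual d n x - dot (gs_residual d n x) (gram_schmidt d n) *: gram_schmidt d n.
Proof. by []. Qed.

Lemma gs_residualB d n x y :
  gs_residual d n (x - y) = gs_residual d n x - gs_residual d n y.
Proof.
elim: n => [//|n ih]; rewrite !gs_residualS ih dotBl scalerBl.
by rewrite !opprD !opprK addrACA.
Qed.

Lemma gs_residual_orthogonal d n x i : (i < n)%N ->
  dot (gs_residual d n x) (gram_schmidt d i) = 0.
Proof.
elim: n x => [//|n ih] x; rewrite ltnS leq_eqVlt gs_residualS dotBl dotZl.
case/predU1P => [->|ni].
  rewrite dot_normalize_self; have [->|_] := eqVneq (gram_schmidt d n) 0.
    by rewrite dot0r mul0r subrr.
  by rewrite mulr1 subrr.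
by rewrite ih// [dot (gram_schmidt d n) _]dotZl ih// !mulr0 subrr.
Qed.

Lemma gram_schmidt_orthonormal d : orthonormal_or_zero (gram_schmidt d).
Proof.
move=> i j; have [ij|ji|->] := ltngtP i j; last by rewrite dot_normalize_self.
  by rewrite dotC dotZl gs_residual_orthogonal// mulr0 conjC0.
by rewrite dotZl gs_residual_orthogonal// mulr0.
Qed.

Lemma gs_residual_le d n x : rnorm (gs_residual d n x) <= rnorm x.
Proof.
elim: n => [//|n]; apply: le_trans; rewrite gs_residualS.
set y := gs_residual d n x; set e := gram_schmidt d n.
rewrite -(@ler_pXn2r _ 2) ?nnegrE ?rnorm_ge0// (rnormB_sqr dot_norm) dotZr.
rewrite [X in complex.Re X]mulrC mul_conjC_rnorm /= rnormZ exprMn.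
have : rnorm e ^+ 2 <= 1.
  rewrite -lecR -(dotxx dot_norm) dot_normalize_self.
  by case: (_ != 0) => /=; rewrite ?ler01 ?lexx.
by have := sqr_ge0 (rnorm (dot y e)); nra.
Qed.

(** Step k removes from the residual of [d k] its component along its own normalization, which is
    all of it. *)
Lemma gs_residual_eq0 d n k : (k < n)%N -> gs_residual d n (d k) = 0.
Proof.
elim: n => [//|n ih]; rewrite ltnS leq_eqVlt gs_residualS => /predU1P[->|/ih ->].
  by rewrite dot_normalize rnorm_normalizeK subrr.
by rewrite dot0l scale0r subrr.
Qed.

Lemma gram_schmidt_sum d f n :
  \sum_(0 <= i < n) dot f (gram_schmidt d i) *: gram_schmidt d i =
  f - gs_residual d n f.
Proof.
elim: n => [|n ih]; first by rewrite big_geq// subrr.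
rewrite big_nat_recr//= -/(gram_schmidt d n) ih opprB [RHS]addrA [RHS]addrAC.
congr (_ - _ + _).
(* The coefficients of f and of its residual agree, because their difference lies in the span of the
   earlier vectors. *)
congr (_ *: _); apply/eqP; rewrite -subr_eq0 -dotBl -ih dot_suml big_nat_cond big1// => i.
rewrite andbT => /andP[_ ni]; rewrite dotZl gram_schmidt_orthonormal.
by rewrite (ltn_eqF ni) mulr0.
Qed.

(** Past index k the residual of f equals that of f - d k, whose norm is at most |f - d k|. *)
Lemma gram_schmidt_cvg d f :
  (forall eps : R, 0 < eps -> exists k, rnorm (f - d k) < eps) ->
  series (fun n => dot f (gram_schmidt d n) *: gram_schmidt d n) @ \oo --> f.
Proof.
move=> df; apply/cvg_rnormP => eps /df[k dk]; exists k.+1 => n kn.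
rewrite /series /= gram_schmidt_sum opprB addrC subrK.
rewrite -[gs_residual d n f]subr0 -(gs_residual_eq0 d kn) -gs_residualB.
by rewrite (le_lt_trans (gs_residual_le _ _ _)).
Qed.

Lemma separable_dense_sequence : separable_space H ->
  exists d, forall f (eps : R), 0 < eps -> exists k, rnorm (f - d k) < eps.
Proof.
move=> [D /countable_injP[c cinj] Dd].
(* [d] inverts the coding [c] of D; indices coding no point get the filler 0. *)
have /choice[d dP] : forall n, exists x, (exists2 y, D y & c y = n) -> D x /\ c x = n.
  move=> n; have [[y Dy yn]|nD] := pselect (exists2 y, D y & c y = n).
    by exists y.
  by exists 0 => /nD.
exists d => f eps eps0.
have epsC : 0 < eps%:C by rewrite ltcR.
have ob : open (ball f eps%:C) by exact: ball_open.
have [|x []] := Dd _ _ ob.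
  by exists f; exact: ballxx.
rewrite -ball_normE /= -rnormE ltcR => fx Dx.
have [|Dd' dc] := dP (c x); first by exists x.
by exists (c x); rewrite (cinj _ _ _ _ dc) ?inE.
Qed.

End Orthonormal.

(** * Interleaving two unconditionally convergent series *)

Section Interleave.

Definition interleave (T : Type) (x y : nat -> T) n := if odd n then y n./2 else x n./2.

(* [P] is the range of the injection [emb]. The elements of [P] listed by [s]
   are, in order, [emb (t 0)], [emb (t 1)], ..., for a permutation [t]. *)
Lemma subpermutation (P : pred nat) (emb proj s : nat -> nat) :
  cancel emb proj -> (forall k, P (emb k)) -> {in P, cancel proj emb} ->
  bijective s -> exists k t : nat -> nat,
  [/\ bijective t, k @ \oo --> \oo &
    forall (V : nmodType) (x : nat -> V) n,
      \sum_(0 <= i < n | P (s i)) x (proj (s i)) = \sum_(0 <= j < k n) x (t j)].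
Proof.
move=> embK Pemb projK [s' sK s'K].
pose k n := (\sum_(0 <= i < n) P (s i))%N.
have kS n : k n.+1 = (k n + P (s n))%N by rewrite /k big_nat_recr.
have kle : {homo k : m n / (m <= n)%N}.
  by apply: homo_leq => // [m n p|n]; [exact: leq_trans|rewrite kS leq_addr].
have kinj p p' : P (s p) -> P (s p') -> k p = k p' -> p = p'.
  wlog pp' : p p' / (p <= p')%N => [W|] Pp Pp' kk.
    by have [/W|/ltnW/W h] := leqP p p'; [exact|apply/esym; exact: h].
  move: pp'; rewrite leq_eqVlt => /predU1P[//|/kle].
  by rewrite kS Pp kk addn1 ltnn.
(* [pos x] is the place where [s] lists [emb x], and [k] counts the elements of [P] listed earlier;
   [t] will be the inverse of [k \o pos]. *)
pose pos x := s' (emb x).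
have spos x : s (pos x) = emb x by rewrite /pos s'K.
have posinj : injective pos.
  by move=> x y /(congr1 s); rewrite !spos => /(can_inj embK).
have late n : exists x, (n <= pos x)%N.
  apply: contrapT => nx; have lt x : (pos x < n)%N.
    by rewrite ltnNge; apply/negP => h; apply: nx; exists x.
  pose h (i : 'I_n.+1) : 'I_n := Ordinal (lt i).
  have /leq_card : injective h.
    by move=> i j [/posinj ij]; exact: val_inj.
  by rewrite !card_ord ltnn.
have kinf j : exists n, (j <= k n)%N.
  elim: j => [|j [n jn]]; first by exists 0%N.
  have [x nx] := late n; exists (pos x).+1.
  by rewrite kS spos Pemb addn1 ltnS (leq_trans jn)// kle.
(* The least n with k n > j is p + 1, where p is the place of element number j of [P], counting from
   0. *)
have ktau j : exists x, k (pos x) = j.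
  have /ex_minnP[[|p]] := kinf j.+1; first by rewrite /k big_geq.
  rewrite kS => jp /(_ p) min; have kp : (k p <= j)%N.
    by rewrite leqNgt; apply/negP => /min; rewrite ltnn.
  have Pp : P (s p).
    by apply/negPn/negP => /negPf Pp; move: jp; rewrite Pp addn0 ltnNge kp.
  exists (proj (s p)); rewrite /pos projK// sK.
  by apply/eqP; move: jp; rewrite Pp addn1 ltnS eqn_leq kp.
have [t tk] := choice ktau.
have kt x : t (k (pos x)) = x.
  by apply: posinj; apply: kinj; rewrite ?spos ?tk.
exists k, t; split; first by exists (k \o pos).
- apply/cvgnyPge => j; have [n jn] := kinf j.
  by exists n => // p /= np; rewrite (leq_trans jn)// kle.
- move=> V x; elim=> [|n ih]; first by rewrite /k !big_geq.
  rewrite big_mkcond big_nat_recr//= -big_mkcond ih kS.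
  have [Pn|_] := boolP (P (s n)); last by rewrite addn0 addr0.
  rewrite addn1 big_nat_recr//=; congr (_ + x _).
  by rewrite -[in k n](sK n) -(projK _ Pn) kt.
Qed.

Variables (K : numFieldType) (V : normedModType K).
Implicit Types x y : nat -> V.

(** A partial sum of a rearrangement splits by parity into partial sums of rearrangements of [x] and
    [y], whose lengths tend to infinity. *)
Lemma unconditionally_convergent_interleave x y :
  unconditionally_convergent x -> unconditionally_convergent y ->
  unconditionally_convergent (interleave x y).
Proof.
move=> ux uy s sbij.
have [|||k [t [tbij koo kx]]] :=
    @subpermutation (fun n => ~~ odd n) double half s _ _ _ sbij.
- exact: doubleK.
- by move=> n; rewrite odd_double.
- move=> n on; have {}on : ~~ odd n := on.
  by rewrite -[RHS]odd_double_half (negPf on).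
have [|||k' [t' [t'bij k'oo k'y]]] :=
    @subpermutation odd (fun n => n.*2.+1) half s _ _ _ sbij.
- exact: uphalf_double.
- by move=> n; rewrite /= odd_double.
- by move=> n on; have {}on : odd n := on; rewrite -[RHS]odd_double_half on.
have -> : series (interleave x y \o s) =
    (fun n => series (x \o t) (k n) + series (y \o t') (k' n)).
  apply/funext => n; rewrite /series /= -kx -k'y (bigID (fun i => odd (s i))) /= addrC.
  congr (_ + _); apply: eq_bigr => i; rewrite /interleave /=.
    by move=> /negPf ->.
  by move=> ->.
have /cvg_ex[a xa] := ux t tbij; have /cvg_ex[b yb] := uy t' t'bij.
apply/cvg_ex; exists (a + b).
by apply: cvgD; [exact: (cvg_comp _ _ koo xa)|exact: (cvg_comp _ _ k'oo yb)].
Qed.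

(** The limit is read off along the partial sums of even length. *)
Lemma cvg_interleave x y (a b : V) : cvgn (series (interleave x y)) ->
  series x @ \oo --> a -> series y @ \oo --> b ->
  limn (series (interleave x y)) = a + b.
Proof.
move=> /cvg_ex[c xyc] xa yb; rewrite (cvg_lim _ xyc)//.
have double_oo : double @ \oo --> \oo.
  by apply/cvgnyPge => j; exists j => // n /= jn;
    rewrite -addnn (leq_trans jn)// leq_addr.
have -> : c = limn (fun n => series (interleave x y) n.*2).
  by apply/esym/cvg_lim => //; exact: (cvg_comp _ _ double_oo xyc).
have -> : (fun n => series (interleave x y) n.*2) = series x + series y.
  apply/funext => n; rewrite -[RHS]/(series x n + series y n).
  elim: n => [|n ih]; first by rewrite /series /= !big_geq// addr0.
  rewrite doubleS !seriesSr ih /interleave /= odd_double /= uphalf_double doubleK.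
  by rewrite addrACA addrA.
by apply: cvg_lim => //; exact: cvgD.
Qed.

End Interleave.

(** * Linearity and boundedness of a multiplier *)

Section MultiplierOperator.
Variables (R : realType) (H : completeNormedModType R[i]).
Variable dot : {dot H for Num.conj}.
Hypothesis dot_norm : forall x : H, dot x x = `|x| ^+ 2.
Variables (m : nat -> R[i]) (phi psi : nat -> H).
Local Notation term := (multiplier_term dot m phi psi).
Local Notation M := (multiplier dot m phi psi).

Lemma multiplier_term_linear n : linear (term ^~ n).
Proof.
by move=> c x y; rewrite /multiplier_term dotDl dotZl mulrDr mulrCA scalerDl scalerA.
Qed.

Hypothesis term_cvg : forall f, cvgn (series (term f)).

Lemma multiplier_linear : linear M.
Proof. exact: (linear_lim_series multiplier_term_linear term_cvg). Qed.

(** The partial sums are bounded operators, pointwise bounded because they converge; their uniform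
    bound passes to the limit. *)
Lemma multiplier_bounded : exists2 C, 0 <= C & forall f, rnorm (M f) <= C * rnorm f.
Proof.
have lin n : linear (fun f => series (term f) n).
  move=> c x y; rewrite /series /= scaler_sumr -big_split /=.
  by apply: eq_bigr => i _; exact: multiplier_term_linear.
have [|||f|C hC] := @uniform_boundedness R H nat (fun n f => rnorm (series (term f) n)).
- by move=> n x y; have /= -> := linear_opD (lin n) x y; exact: rnormD.
- move=> n t x; have s0 : series (term 0) n = 0.
    by have := linear_opB (lin n) 0 0; rewrite !subrr.
  by have := lin n t%:C x 0; rewrite s0 !addr0 => ->; rewrite rnormZ rnorm_realE.
- move=> n; exists (\sum_(0 <= i < n) rnorm (m i) * rnorm (psi i) * rnorm (phi i)) => x.
  rewrite (le_trans (rnorm_sum _ _))// mulr_suml ler_sum// => i _.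
  rewrite rnormZ rnormM [leRHS]mulrAC ler_wpM2r ?rnorm_ge0//.
  rewrite -mulrA ler_wpM2l ?rnorm_ge0//.
  by rewrite mulrC cauchy_schwarz.
- have /cvg_ex[l /cvg_rnormP/(_ 1 ltr01)[N lN]] := @term_cvg f.
  exists (rnorm l + 1 + \sum_(0 <= i < N) rnorm (series (term f) i)) => n.
  have S0 : 0 <= \sum_(0 <= i < N) rnorm (series (term f) i).
    by apply: sumr_ge0 => i _; exact: rnorm_ge0.
  have [Nn|nN] := leqP N n.
    have := rnormB l (l - series (term f) n); rewrite subKr.
    by have := lN n Nn; lra.
  rewrite (bigD1_seq n) ?mem_index_iota ?iota_uniq//= ler_wpDl//.
    by rewrite addr_ge0 ?rnorm_ge0.
  by rewrite lerDl sumr_ge0// => i _; exact: rnorm_ge0.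
exists `|C| => // f.
have /cvg_ex[l fl] := @term_cvg f.
rewrite /multiplier (cvg_lim _ fl)// -[l]subr0.
apply: (rdist_lim_le (n := 0) fl) => n _; rewrite subr0 (le_trans (hC n f))//.
by rewrite ler_wpM2r ?rnorm_ge0 ?ler_norm.
Qed.

End MultiplierOperator.

(** * Passing to even indices and shifting to an invertible operator *)

Section Reduction.
Variables (R : realType) (H : completeNormedModType R[i]).
Variable dot : {dot H for Num.conj}.

Lemma Bessel_even (g : nat -> H) :
  Bessel dot g -> Bessel dot (fun n => g n.*2).
Proof.
move=> /BesselP[B B0 gB]; apply/BesselP; exists B => // f n.
apply: le_trans (gB f n.*2); rewrite /energy.
elim: n => [|n ih]; first by rewrite !big_geq.
by rewrite doubleS !big_nat_recr//= -addrA lerD// lerDl sqr_ge0.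
Qed.

(** Factor M + c as c (1 + M/c) with c = C + 1; then M/c has norm at most C/(C + 1) < 1. *)
Lemma shifted_bijective (M : H -> H) (C : R) : linear M -> 0 <= C ->
  (forall f, rnorm (M f) <= C * rnorm f) ->
  bijective (fun f => M f + (C + 1)%:C *: f).
Proof.
move=> Ml C0 MC; set c := (C + 1)%:C.
have C1 : 0 < C + 1 by lra.
have c0 : c != 0 by rewrite fmorph_eq0 gt_eqF.
have -> : (fun f => M f + c *: f) = (fun f => c *: f) \o (fun f => f + c^-1 *: M f).
  by apply/funext => f /=; rewrite scalerDr scalerA divff// scale1r addrC.
apply: bij_comp.
  by exists (fun f => c^-1 *: f) => f; rewrite scalerA ?mulVf ?divff// scale1r.
apply: (@near_identity_bijective _ _ _ (C / (C + 1))) => [a x y||f].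
- by rewrite Ml !scalerDr !scalerA [c^-1 * a]mulrC addrACA.
- by rewrite divr_ge0 ?(ltW C1)//= ltr_pdivrMr// mul1r; lra.
- rewrite opprD addNKr rnormN rnormZ -fmorphV rnorm_real ?invr_ge0 ?(ltW C1)//.
  by rewrite mulrAC [leRHS]mulrC ler_wpM2l ?invr_ge0 ?(ltW C1).
Qed.

End Reduction.

(** * The equivalence of (M1) and (M2) *)

Theorem theorem4p11 (R : realType) (H : completeNormedModType R[i])
    (dot : {dot H for Num.conj})
    (dot_norm : forall x : H, dot x x = `|x| ^+ 2)
    (H_infinite : infinite_dimensional H)
    (H_separable : separable_space H) :
  (forall (m : nat -> R[i]) (phi psi : nat -> H),
     unconditionally_convergent_multiplier dot m phi psi ->
     exists a b : nat -> R[i],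
       [/\ Bessel dot (fun n => a n *: phi n),
           Bessel dot (fun n => b n *: psi n) &
           forall n, a n * (b n)^* = m n])
  <->
  (forall (m : nat -> R[i]) (phi psi : nat -> H),
     unconditionally_convergent_multiplier dot m phi psi ->
     invertible_operator (multiplier dot m phi psi) ->
     exists a b : nat -> R[i],
       [/\ frame dot (fun n => a n *: phi n),
           frame dot (fun n => b n *: psi n) &
           forall n, a n * (b n)^* = m n]).
Proof.
split=> [M1 m phi psi ucv [_ bijM]|M2 m phi psi ucv].
  have [a [b [aphi bpsi abm]]] := M1 m phi psi ucv.
  have ME : multiplier dot m phi psi =
      analysis_synthesis dot (fun n => a n *: phi n) (fun n => b n *: psi n).
    apply/funext => f; congr (limn (series _)); apply/funext => n.
    by rewrite dotZr scalerA mulrAC [_^* * a n]mulrC abm.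
  rewrite ME in bijM.
  have [fphi fpsi] := analysis_synthesis_frames dot_norm aphi bpsi bijM.
  by exists a, b.
have [d dd] := separable_dense_sequence H_separable.
(* An orthonormal basis possibly padded with zero vectors, which leave the expansion of f
   unchanged. *)
pose e := gram_schmidt dot d.
have Mcvg f : cvgn (series (multiplier_term dot m phi psi f)).
  by apply: (ucv f id); exists id.
have Ml := multiplier_linear Mcvg.
have [C C0 MC] := multiplier_bounded dot_norm Mcvg.
pose c := (C + 1)%:C.
pose m' := interleave m (fun=> c).
pose phi' := interleave phi e; pose psi' := interleave psi e.
pose I f n := c *: (dot f (e n) *: e n).
have termE f : multiplier_term dot m' phi' psi' f =
    interleave (multiplier_term dot m phi psi f) (I f).
  apply/funext => n; rewrite /multiplier_term /m' /phi' /psi' /interleave /I.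
  by case: (odd n) => //=; rewrite [RHS]scalerA.
have Iucv f : unconditionally_convergent (I f).
  move=> s sbij.
  have -> : I f \o s = c *: ((fun n => dot f (e n) *: e n) \o s) by [].
  rewrite seriesZ; apply: is_cvgZl_tmp.
  exact: orthonormal_expansion_unconditional (gram_schmidt_orthonormal _ _) _ sbij.
have Icvg f : series (I f) @ \oo --> c *: f.
  have -> : I f = c *: (fun n => dot f (e n) *: e n) by [].
  by rewrite seriesZ; apply: cvgZl_tmp; exact: (gram_schmidt_cvg dot_norm (dd f)).
have ucv' : unconditionally_convergent_multiplier dot m' phi' psi'.
  by move=> f; rewrite termE; exact: unconditionally_convergent_interleave.
have M'E : multiplier dot m' phi' psi' = (fun f => multiplier dot m phi psi f + c *: f).
  apply/funext => f; rewrite {1}/multiplier termE; apply: cvg_interleave => //.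
  by rewrite -termE; apply: (ucv' f id); exists id.
have [|a [b [fa fb abm]]] := M2 m' phi' psi' ucv'.
  rewrite M'E; split; last exact: shifted_bijective.
  split; first by move=> k x y; rewrite Ml !scalerDr !scalerA [c * k]mulrC addrACA.
  exists (C + (C + 1)) => f; rewrite (le_trans (rnormD _ _))// mulrDl lerD//.
  by rewrite rnormZ rnorm_real//; lra.
have even_interleave (T : Type) (x y : nat -> T) n : interleave x y n.*2 = x n.
  by rewrite /interleave odd_double doubleK.
have frame_Bessel g : frame dot g -> Bessel dot g.
  by move=> [A [B [_ B0 gB]]]; exists B => // f; have [] := gB f.
(* The even indices carry the original multiplier; the Bessel bound passes to this subsequence. *)
exists (fun n => a n.*2), (fun n => b n.*2); split => [||n].
- have := Bessel_even (frame_Bessel _ fa).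
  by congr (Bessel dot _); apply/funext => n; rewrite /phi' even_interleave.
- have := Bessel_even (frame_Bessel _ fb).
  by congr (Bessel dot _); apply/funext => n; rewrite /psi' even_interleave.
- by rewrite abm /m' even_interleave.
Qed.
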